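(* Let $X$ be a finite set, and let $(X,S)$ be a non-degenerate symmetric set-theoretical solution of the quantum Yang-Baxter equation. Let $G=G(X,S)$ be its structure group, equipped with its canonical Garside structure. For $Y\subseteq X$, denote by $G_Y$ the subgroup of $G$ generated by $Y$. Then the map $Y\mapsto G_Y$ induces a one-to-one correspondence (a bijection) between the set of invariant non-degenerate subsets of $(X,S)$ and the set of standard parabolic subgroups of $G$.
   Context: Solutions. Let $X$ be a set and $S:X\times X\to X\times X$ a bijection; write $S(x,y)=(g_x(y),f_y(x))$. The pair $(X,S)$ is non-degenerate if $f_x$ and $g_x$ are bijections of $X$ for every $x\in X$; involutive if $S\circ S=\mathrm{id}_{X\times X}$; braided if $S^{12}S^{23}S^{12}=S^{23}S^{12}S^{23}$ on $X^3$, where $S^{12}=S\times \mathrm{id}_X$, $S^{23}=\mathrm{id}_X\times S$; symmetric if it is involutive and braided. A non-degenerate symmetric set-theoretical solution of the quantum Yang-Baxter equation is a pair $(X,S)$ that is non-degenerate and symmetric. Its structure group is $G(X,S)=\langle X\mid xy=g_x(y)f_y(x)\ \ (x,y\in X)\rangle$. A subset $Y\subseteq X$ is invariant if $S(Y\times Y)\subseteq Y\times Y$; an invariant subset $Y$ is non-degenerate if $(Y,S|_{Y\times Y})$ is non-degenerate and symmetric. Garside monoids. In a monoid, $x$ is a left (resp. right) divisor of $z$ if $z=xt$ (resp. $z=tx$) for some $t$. A monoid is cancellative if $xyz=xtz$ implies $y=t$. It is noetherian if every sequence $(x_n)$ in which each $x_{n+1}$ is a left divisor of $x_n$ stabilizes,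 and likewise for right divisors. A locally Garside monoid is a cancellative noetherian monoid in which, for each of left-divisibility and right-divisibility, any two elements have a common multiple if and only if they have a least common multiple. An element $\Delta$ is balanced if its sets of left and right divisors coincide; this set is then denoted $\operatorname{Div}(\Delta)$. A Garside element is a balanced element $\Delta$ such that $\operatorname{Div}(\Delta)$ generates the monoid; a Garside monoid is a locally Garside monoid having a Garside element. A Garside monoid has a unique minimal Garside element, called the Garside element. A Garside group is the enveloping group $G(M)$ of a Garside monoid $M$ (and $M$ embeds in $G(M)$). Canonical Garside structure of $G(X,S)$ ($X$ finite): the submonoid $M$ of $G(X,S)$ generated by $X$ has, as a monoid, the same presentation as $G(X,S)$; it is a Garside monoid with atom set $X$ and enveloping group $G(X,S)$. Its Garside element is denoted $\Delta$. Standard parabolic subgroups. A submonoid $N$ of $M$ is standard parabolic if there is a balanced $\delta\in\operatorname{Div}(\Delta)$ such that $\operatorname{Div}(\delta)$ generates $N$ and $N\cap\operatorname{Div}(\Delta)=\operatorname{Div}(\delta)$. A standard parabolic subgroup of $G$ is a subgroup generated by a standard parabolic submonoid of $M$. *)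

(* Defs.v *)
From HB Require Import structures.
From mathcomp Require Import all_boot generic_quotient.
From mathcomp Require Import boolp classical_sets functions.

Set Implicit Arguments.
Unset Strict Implicit.
Unset Printing Implicit Defensive.

Local Open Scope classical_set_scope.
Local Open Scope group_scope.
Local Open Scope quotient_scope.

Section Presentation.
Variable X : choiceType.

(* The letter (x, false) stands for the generator x, (x, true) for its inverse. *)
Definition word := seq (X * bool).

Definition letter_inv (a : X * bool) : X * bool := (a.1, ~~ a.2).
Definition word_inv (w : word) : word := rev (map letter_inv w).

Variable R : word -> word -> Prop.

Inductive word_equiv : word -> word -> Prop :=
| we_refl u : word_equiv u u
| we_sym u v : word_equiv u v -> word_equiv v u
| we_trans v u w : word_equiv u v -> word_equiv v w -> word_equiv u w
| we_cat u u' v v' :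
    word_equiv u u' -> word_equiv v v' -> word_equiv (u ++ v) (u' ++ v')
| we_free a : word_equiv [:: a; letter_inv a] [::]
| we_rel u v : R u v -> word_equiv u v.

Definition word_eqb (u v : word) : bool := `[< word_equiv u v >].

Lemma word_eqb_refl : reflexive word_eqb.
Proof. by move=> u; apply/asboolP/we_refl. Qed.

Lemma word_eqb_sym : symmetric word_eqb.
Proof. by move=> u v; apply/asboolP/asboolP; apply: we_sym. Qed.

Lemma word_eqb_trans : transitive word_eqb.
Proof. by move=> v u w /asboolP uv /asboolP vw; apply/asboolP/(we_trans uv). Qed.

Canonical word_eqb_equiv :=
  EquivRel word_eqb word_eqb_refl word_eqb_sym word_eqb_trans.

(* The group < X | u = v for (u, v) in R >. *)
Definition presented_group := {eq_quot word_eqb}.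
HB.instance Definition _ := Choice.on presented_group.

Definition pg_class (w : word) : presented_group := \pi_({eq_quot word_eqb}) w.
Definition pg_one : presented_group := pg_class [::].
Definition pg_mul (a b : presented_group) : presented_group :=
  pg_class (repr a ++ repr b).
Definition pg_inv (a : presented_group) : presented_group :=
  pg_class (word_inv (repr a)).

Lemma pg_classP u v : pg_class u = pg_class v <-> word_equiv u v.
Proof.
split=> [/eqmodP/asboolP //|uv]; by apply/eqmodP/asboolP.
Qed.

Lemma pg_classK a : pg_class (repr a) = a.
Proof. exact: reprK. Qed.

Lemma repr_class w : word_equiv (repr (pg_class w)) w.
Proof. by apply/pg_classP; rewrite pg_classK. Qed.

Lemma pg_mulE u v : pg_mul (pg_class u) (pg_class v) = pg_class (u ++ v).
Proof. by apply/pg_classP; apply: we_cat; apply: repr_class. Qed.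

Lemma letter_invK : involutive letter_inv.
Proof. by case=> x b; rewrite /letter_inv negbK. Qed.

Lemma word_invK : involutive word_inv.
Proof.
by move=> w; rewrite /word_inv map_rev revK -map_comp map_id_in // => a _;
  apply: letter_invK.
Qed.

Lemma word_mulV w : word_equiv (w ++ word_inv w) [::].
Proof.
elim: w => [|a w IH]; first exact: we_refl.
rewrite /word_inv /= rev_cons -cats1 -/(word_inv w) catA.
apply: (@we_trans ([:: a] ++ [:: letter_inv a])); last exact: we_free.
apply: (@we_cat (a :: w ++ word_inv w) [:: a]); last exact: we_refl.
by apply: (@we_cat [:: a] [:: a] _ [::]); [exact: we_refl | exact: IH].
Qed.

Lemma word_Vmul w : word_equiv (word_inv w ++ w) [::].
Proof. by rewrite -{2}[w]word_invK; apply: word_mulV. Qed.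

Lemma pg_mulA : associative pg_mul.
Proof.
move=> a b c.
by rewrite -[a]pg_classK -[b]pg_classK -[c]pg_classK !pg_mulE catA.
Qed.

Lemma pg_mul1 : left_id pg_one pg_mul.
Proof. by move=> a; rewrite -[a]pg_classK pg_mulE. Qed.

Lemma pg_mulr1 : right_id pg_one pg_mul.
Proof. by move=> a; rewrite -[a]pg_classK pg_mulE cats0. Qed.

Lemma pg_mulV : left_inverse pg_one pg_inv pg_mul.
Proof.
move=> a; rewrite -{2}[a]pg_classK pg_mulE.
by apply/pg_classP; apply: word_Vmul.
Qed.

Lemma pg_mulrV : right_inverse pg_one pg_inv pg_mul.
Proof.
move=> a; rewrite -{1}[a]pg_classK pg_mulE.
by apply/pg_classP; apply: word_mulV.
Qed.

HB.instance Definition _ := isGroup.Build presented_group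
  pg_mulA pg_mul1 pg_mulr1 pg_mulV pg_mulrV.

Definition pg_gen (x : X) : presented_group := pg_class [:: (x, false)].

End Presentation.

Section Solutions.
Variables (X : Type) (S : X * X -> X * X).

(* S (x, y) = (g_x y, f_y x) *)
Definition sol_g (x y : X) : X := (S (x, y)).1.
Definition sol_f (y x : X) : X := (S (x, y)).2.

Definition nondegenerate : Prop :=
  forall x, bijective (sol_f x) /\ bijective (sol_g x).

Definition S12 (t : X * X * X) : X * X * X := (S t.1, t.2).
Definition S23 (t : X * X * X) : X * X * X :=
  let: (x, y, z) := t in let: (y', z') := S (y, z) in (x, y', z').

Definition braided : Prop := forall t, S12 (S23 (S12 t)) = S23 (S12 (S23 t)).

Definition nondegenerate_symmetric : Prop :=
  [/\ bijective S, nondegenerate, involutive S & braided].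

Definition invariant (Y : set X) : Prop := S @` (Y `*` Y) `<=` Y `*` Y.

Lemma invariant_in (Y : set X) : invariant Y ->
  forall p : Y * Y, (S (val p.1, val p.2)).1 \in Y /\ (S (val p.1, val p.2)).2 \in Y.
Proof.
move=> invY [[x xY] [y yY]] /=.
have /invY[h1 h2] : (S @` (Y `*` Y)) (S (x, y)).
  by exists (x, y) => //; split; exact: set_mem.
by split; apply: mem_set.
Qed.

Definition restriction (Y : set X) (invY : invariant Y) (p : Y * Y) : Y * Y :=
  (exist (fun z => z \in Y) _ (proj1 (invariant_in invY p)),
   exist (fun z => z \in Y) _ (proj2 (invariant_in invY p))).

End Solutions.

Definition invariant_nondegenerate (X : Type) (S : X * X -> X * X) (Y : set X) :
    Prop :=
  exists invY : invariant S Y, nondegenerate_symmetric (restriction invY).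

Section Generated.

Definition is_submonoid (T : monoidType) (N : set T) : Prop :=
  N 1 /\ forall x y, N x -> N y -> N (x * y).

Definition is_subgroup (T : groupType) (H : set T) : Prop :=
  is_submonoid H /\ forall x, H x -> H x^-1.

Definition submonoid_gen (T : monoidType) (A : set T) : set T :=
  smallest (@is_submonoid T) A.

Definition subgroup_gen (T : groupType) (A : set T) : set T :=
  smallest (@is_subgroup T) A.

End Generated.

(* M is a submonoid of T, regarded as a monoid in its own right: quotients,
   multiples and divisors are all taken inside M. *)
Section Garside.
Variables (T : monoidType) (M : set T).
Implicit Types x y z t d : T.

Definition ldivides x z : Prop := exists2 t, M t & z = x * t.
Definition rdivides x z : Prop := exists2 t, M t & z = t * x.

Definition ldivisors z : set T := [set x | M x /\ ldivides x z].
Definition rdivisors z : set T := [set x | M x /\ rdivides x z].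

Definition cancellative : Prop :=
  forall x y t z, M x -> M y -> M t -> M z -> x * y * z = x * t * z -> y = t.

Definition noetherian_for (dv : T -> T -> Prop) : Prop :=
  forall u : nat -> T, (forall n, M (u n)) -> (forall n, dv (u n.+1) (u n)) ->
    exists n0, forall n, n0 <= n -> u n = u n0.

Definition common_multiple (dv : T -> T -> Prop) x y z : Prop :=
  [/\ M z, dv x z & dv y z].

Definition least_common_multiple (dv : T -> T -> Prop) x y m : Prop :=
  common_multiple dv x y m /\ forall z, common_multiple dv x y z -> dv m z.

Definition has_conditional_lcms (dv : T -> T -> Prop) : Prop :=
  forall x y, M x -> M y ->
    (exists z, common_multiple dv x y z) <->
    (exists m, least_common_multiple dv x y m).

Definition locally_garside : Prop :=
  [/\ is_submonoid M, cancellative,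
      noetherian_for ldivides /\ noetherian_for rdivides
    & has_conditional_lcms ldivides /\ has_conditional_lcms rdivides].

Definition balanced d : Prop := M d /\ ldivisors d = rdivisors d.

(* Only meant for balanced d, where left and right divisors agree. *)
Definition Div d : set T := ldivisors d.

Definition garside_element d : Prop :=
  balanced d /\ submonoid_gen (Div d) = M.

Definition garside_monoid : Prop :=
  locally_garside /\ exists d, garside_element d.

(* Since d is balanced, d' divides d on the left iff it does on the right, so
   minimality does not depend on a side. *)
Definition minimal_garside_element d : Prop :=
  [/\ garside_monoid, garside_element d
    & forall d', garside_element d' -> ldivides d' d -> d' = d].

Definition standard_parabolic_submonoid (N : set T) : Prop :=
  exists D d, [/\ minimal_garside_element D, balanced d, Div D d,
    N = submonoid_gen (Div d) & N `&` Div D = Div d].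

End Garside.

Definition standard_parabolic_subgroup (T : groupType) (M : set T) (H : set T) :
    Prop :=
  exists2 N, standard_parabolic_submonoid M N & H = subgroup_gen N.

Section StructureGroup.
Variables (X : choiceType) (S : X * X -> X * X).

Definition structure_relation (u v : word X) : Prop :=
  exists x y, u = [:: (x, false); (y, false)] /\
              v = [:: (sol_g S x y, false); (sol_f S y x, false)].

Definition structure_group := presented_group structure_relation.
HB.instance Definition _ := Group.on structure_group.

Definition structure_gen (x : X) : structure_group :=
  pg_gen structure_relation x.

Definition structure_monoid : set structure_group :=
  submonoid_gen (range structure_gen).

Definition G_ (Y : set X) : set structure_group :=
  subgroup_gen (structure_gen @` Y).

End StructureGroup.

Arguments structure_gen {X} S x.
Arguments structure_monoid {X} S.
Arguments G_ {X} S Y.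

(* Main.v *)
(* Since g_x g_y = g_{g_x y} g_{f_y x}, the structure group G acts on X through
   x |-> g_x, and involutivity makes x |-> e_x extend to a 1-cocycle
   pi : G -> Z^X, pi (h k) = pi h + h . pi k.  The defining relations let any
   generator in the support of pi m be moved to the front of m in M; hence pi is
   injective on M, and with the help of the element D with pi D = (1, ..., 1),
   which normalizes M and is a multiple of every generator, pi is a bijection
   G -> Z^X with M = {h | pi h >= 0}.  Left divisibility becomes the pointwise
   order of pi, and right divisibility that of rho h = h^-1 . pi h, so the
   Garside properties are those of N^X and D is the Garside element.
   An invariant subset Y is stable under G_Y, which makes the element d with
   pi d = 1_Y balanced, with the divisors of d lying in the monoid generated by
   Y.  Conversely, for a standard parabolic N = <Div d>, the generators dividing
   d form an invariant subset, because a product x y of two of them either is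
   fixed by S, or divides D and thus lies in N `&` Div D = Div d. *)
Require Import Defs.
From mathcomp Require Import all_boot all_order perm ssralg ssrnum ssrint zify.
From mathcomp Require Import boolp classical_sets functions.

Set Implicit Arguments.
Unset Strict Implicit.
Unset Printing Implicit Defensive.

Import Order.TTheory GRing.Theory Num.Theory.
Local Open Scope classical_set_scope.
Local Open Scope group_scope.

(** * Generated submonoids and subgroups *)

Lemma submonoid_gen_submonoid (T : monoidType) (A : set T) :
  is_submonoid (submonoid_gen A).
Proof.
split=> [H [[]] //|x y Ax Ay H subH]; have [[_ HM] _] := subH.
by apply: HM; [apply: Ax | apply: Ay].
Qed.

Lemma subgroup_gen_subgroup (T : groupType) (A : set T) :
  is_subgroup (subgroup_gen A).
Proof.
split; last by move=> x Ax H subH; have [[_ HV] _] := subH; apply: HV; apply: Ax.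
split=> [H [[[]]] //|x y Ax Ay H subH]; have [[[_ HM] _] _] := subH.
by apply: HM; [apply: Ax | apply: Ay].
Qed.

(** * Stationarity of nonincreasing sequences *)

Section NonincreasingVectors.

Lemma nonincreasing_nat_stationary (d : nat -> nat) :
  (forall n, (d n.+1 <= d n)%N) ->
  exists n0, forall n, (n0 <= n)%N -> d n = d n0.
Proof.
move=> dS.
have exP : exists m, `[< exists n, d n = m >].
  by exists (d 0); apply/asboolP; exists 0.
case: (ex_minnP exP) => _ /asboolP[n0 <-] min_d.
exists n0 => n le_n0n; apply/eqP; rewrite eqn_leq; apply/andP; split; last first.
  by apply: min_d; apply/asboolP; exists n.
rewrite -(subnKC le_n0n); elim: (n - n0)%N => [|k IHk]; first by rewrite addn0.
by rewrite addnS (leq_trans (dS _)).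
Qed.

(** The sum of the entries is a nonincreasing sequence of naturals; once it is constant, the
    termwise inequalities are equalities. *)
Lemma nonincreasing_nneg_stationary (X : finType) (v : nat -> X -> int) :
  (forall n y, 0 <= v n y)%R -> (forall n y, v n.+1 y <= v n y)%R ->
  exists n0, forall n, (n0 <= n)%N -> v n =1 v n0.
Proof.
move=> v_ge0 vS.
have [|n0 stat] := @nonincreasing_nat_stationary (fun n => (\sum_y `|v n y|)%N).
  move=> n; apply: leq_sum => y _; have := vS n y; have := v_ge0 n.+1 y; lia.
exists n0 => n le_n0n.
have le_v y : (v n y <= v n0 y)%R.
  rewrite -(subnKC le_n0n); elim: (n - n0)%N => [|k IHk]; first by rewrite addn0.
  by rewrite addnS (le_trans (vS _ _)).
have le_abs y : true -> `|v n y| <= `|v n0 y| ?= iff (`|v n y| == `|v n0 y|)%N.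
  by move=> _; split=> //; have := le_v y; have := v_ge0 n y; lia.
have [_] := leqif_sum le_abs; rewrite stat // eqxx => /esym/forallP eq_abs y.
have := eq_abs y; have := v_ge0 n y; have := v_ge0 n0 y; lia.
Qed.

End NonincreasingVectors.

(** * The action and the cocycle on the structure group *)

Section Cocycle.
Variables (X : finType) (S : X * X -> X * X).
Hypothesis hS : nondegenerate_symmetric S.

Local Notation G := (structure_group S).
Local Notation g_ := (sol_g S).
Local Notation f_ := (sol_f S).
Local Notation gen := (structure_gen S).
Local Notation M := (structure_monoid S).

Lemma sol_pairE x y : S (x, y) = (g_ x y, f_ y x).
Proof. by rewrite /sol_g /sol_f; case: (S _). Qed.

Lemma sol_g_inj x : injective (g_ x).
Proof. by have [_ nd _ _] := hS; apply: bij_inj; exact: (nd x).2. Qed.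

Lemma sol_f_inj x : injective (f_ x).
Proof. by have [_ nd _ _] := hS; apply: bij_inj; exact: (nd x).1. Qed.

Lemma sol_invol x y : g_ (g_ x y) (f_ y x) = x.
Proof.
have [_ _ inv _] := hS.
by have := inv (x, y); rewrite (sol_pairE x y) sol_pairE => -[].
Qed.

(** This is the first coordinate of the braid equation at (x, y, z); it makes x |-> g_x compatible
    with the defining relations. *)
Lemma sol_g_comp x y z : g_ (g_ x y) (g_ (f_ y x) z) = g_ x (g_ y z).
Proof.
have [_ _ _ br] := hS; have := br (x, y, z).
rewrite /S12 /S23 /= !sol_pairE /=.
by case.
Qed.

Definition g_perm x : {perm X} := perm (@sol_g_inj x).

(* The structure group acts on the left of X by x |-> g_x; as permutations
   multiply on the right in MathComp, the morphism into {perm X} sends x to the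
   inverse of g_x, i.e. [phi h] is the action of h^-1, and the cocycle rule reads
   [pi (h * k) y = pi h y + pi k (phi h y)]. *)
Definition letter_phi (a : X * bool) : {perm X} :=
  if a.2 then g_perm a.1 else (g_perm a.1)^-1.
Definition word_phi (w : word X) : {perm X} :=
  foldr (fun a s => letter_phi a * s) 1 w.

(** The value at an inverse letter is forced by the cocycle rule applied to x^-1 x, where [phi] of
    x^-1 is g_x. *)
Definition letter_pi (a : X * bool) (y : X) : int :=
  if a.2 then (- Posz (g_perm a.1 y == a.1))%R else Posz (y == a.1).
Fixpoint word_pi (w : word X) (y : X) : int :=
  if w is a :: w' then (letter_pi a y + word_pi w' (letter_phi a y))%R else 0%R.

Lemma word_phi_cat u v : word_phi (u ++ v) = word_phi u * word_phi v.
Proof. by elim: u => [|a u IHu] /=; rewrite ?mul1g // IHu mulgA. Qed.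

Lemma word_pi_cat u v y :
  word_pi (u ++ v) y = (word_pi u y + word_pi v (word_phi u y))%R.
Proof.
elim: u y => [|a u IHu] y /=; first by rewrite perm1 add0r.
by rewrite IHu permM addrA.
Qed.

Lemma g_perm_rel x y :
  (g_perm (g_ x y))^-1 * (g_perm (f_ y x))^-1 =
  ((g_perm x)^-1 * (g_perm y)^-1)%g.
Proof.
rewrite -!invgM; congr _^-1; apply/permP => z.
by rewrite !permM !permE sol_g_comp.
Qed.

Lemma word_equiv_phi_pi u v : word_equiv (structure_relation S) u v ->
  word_phi u = word_phi v /\ word_pi u =1 word_pi v.
Proof.
elim=> {u v} [//|u v _ [-> e]|v u w _ [-> e1] _ [-> e2]||[x []]|u v [x [y [-> ->]]]].
- by split=> // y; rewrite e.
- by split=> // y; rewrite e1.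
- move=> u u' v v' _ [e1 e2] _ [e3 e4].
  by rewrite !word_phi_cat e1 e3; split=> // y; rewrite !word_pi_cat e1 e2 e4.
- split=> [|y]; rewrite /= /letter_phi /letter_pi /= ?mulg1 ?mulgV //.
  by rewrite addr0 addNr.
- split=> [|y]; rewrite /= /letter_phi /letter_pi /= ?mulg1 ?mulVg //.
  by rewrite permKV; lia.
- split=> [|z]; first by rewrite /= /letter_phi /= !mulg1 g_perm_rel.
  rewrite /= /letter_phi /letter_pi /= !addr0.
  have permV_eq a b : ((g_perm a)^-1 z == b) = (z == g_ a b).
    by rewrite -(inj_eq (@perm_inj _ (g_perm a))) permKV permE.
  (* By involutivity both words have cocycle e_x + e_{g_x y}, with the two terms in opposite
     orders. *)
  by rewrite !permV_eq sol_invol addrC.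
Qed.

Definition phi (h : G) : {perm X} := word_phi (repr h).
Definition pi (h : G) : X -> int := word_pi (repr h).

Lemma phi_class w : phi (pg_class (structure_relation S) w) = word_phi w.
Proof. by have [] := word_equiv_phi_pi (repr_class (structure_relation S) w). Qed.

Lemma pi_class w : pi (pg_class (structure_relation S) w) =1 word_pi w.
Proof. by have [] := word_equiv_phi_pi (repr_class (structure_relation S) w). Qed.

Lemma phiM h k : phi (h * k) = phi h * phi k.
Proof.
by rewrite -[h]pg_classK -[k]pg_classK [_ * _]pg_mulE !phi_class word_phi_cat.
Qed.

Lemma piM h k y : pi (h * k) y = (pi h y + pi k (phi h y))%R.
Proof.
rewrite -[h]pg_classK -[k]pg_classK [_ * _]pg_mulE !pi_class phi_class.
exact: word_pi_cat.
Qed.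

Lemma phi1 : phi 1 = 1.
Proof. by rewrite [1 in LHS]/(pg_class _ [::]) phi_class. Qed.

Lemma pi1 y : pi 1 y = 0%R.
Proof. by rewrite [1]/(pg_class _ [::]) pi_class. Qed.

Lemma phiV h : phi h^-1 = (phi h)^-1.
Proof. by apply: (mulIg (phi h)); rewrite -phiM !mulVg phi1. Qed.

Lemma piV h y : pi h^-1 y = (- pi h ((phi h)^-1%g y))%R.
Proof. by have := piM h^-1 h y; rewrite mulVg pi1 phiV; lia. Qed.

Lemma phi_gen x : phi (gen x) = (g_perm x)^-1.
Proof. by rewrite phi_class /= /letter_phi mulg1. Qed.

Lemma pi_gen x y : pi (gen x) y = (y == x).
Proof. by rewrite pi_class /= /letter_pi addr0. Qed.

Lemma gen_rel x y : gen x * gen y = gen (g_ x y) * gen (f_ y x).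
Proof.
have genM a b : gen a * gen b = pg_class _ [:: (a, false); (b, false)].
  exact: pg_mulE.
by rewrite !genM; apply/pg_classP/we_rel; exists x, y.
Qed.

(** * Words in the generators and the exchange property *)

Definition gen_word (s : seq X) : G := foldr (fun x h => gen x * h) 1 s.

Lemma gen_word_cat s t : gen_word (s ++ t) = gen_word s * gen_word t.
Proof. by elim: s => [|x s IHs] /=; rewrite ?mul1g // IHs mulgA. Qed.

Lemma pi_gen_word_ge0 s y : (0 <= pi (gen_word s) y)%R.
Proof.
elim: s y => [|x s IHs] y /=; first by rewrite pi1.
by rewrite piM pi_gen; have := IHs (phi (gen x) y); lia.
Qed.

(** If the first letter y is not x, induction brings u = g_y^-1 x to the front of the tail, and the
    relation y u = x (f_u y) then brings x to the front. *)
Lemma gen_word_exchange s x :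
  (0 < pi (gen_word s) x)%R -> exists t, gen_word s = gen x * gen_word t.
Proof.
elim: s x => [|y s IHs] x /=; first by rewrite pi1.
case: (eqVneq x y) => [-> _|neq_xy]; first by exists s.
rewrite piM pi_gen (negPf neq_xy) add0r phi_gen => /IHs[t ->].
exists (f_ ((g_perm y)^-1 x) y :: t).
rewrite mulgA gen_rel /= mulgA; congr (gen _ * _ * _).
by rewrite -[g_ y _](permE (@sol_g_inj y)) permKV.
Qed.

Lemma gen_word_pi_inj s t :
  pi (gen_word s) =1 pi (gen_word t) -> gen_word s = gen_word t.
Proof.
elim: s t => [|x s IHs] t /= eq_pi.
  case: t eq_pi => [//|y t] /(_ y) /=; rewrite pi1 piM pi_gen eqxx.
  by have := pi_gen_word_ge0 t (phi (gen y) y); lia.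
have [|t' def_t] := @gen_word_exchange t x.
  rewrite -eq_pi piM pi_gen eqxx.
  by have := pi_gen_word_ge0 s (phi (gen x) x); lia.
rewrite def_t; congr (_ * _); apply: IHs => y.
have := eq_pi ((phi (gen x))^-1 y).
by rewrite def_t !piM permKV => /addrI.
Qed.

Lemma gen_word_G (Y : set X) s :
  (forall x, x \in s -> Y x) -> G_ S Y (gen_word s).
Proof.
move=> sY H [[[H1 HM] _] subH]; elim: s sY => [|x s IHs] sY //=.
apply: HM; first by apply: subH; exists x => //; apply: sY; rewrite mem_head.
by apply: IHs => y s_y; apply: sY; rewrite inE s_y orbT.
Qed.

Lemma submonoid_gen_wordP (Y : set X) h :
  submonoid_gen (gen @` Y) h <->
  exists2 s : seq X, (forall x, x \in s -> Y x) & h = gen_word s.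
Proof.
split=> [|[s sY ->] H [[H1 HM] subH]]; last first.
  elim: s sY => [|x s IHs] sY //=.
  apply: HM; first by apply: subH; exists x => //; apply: sY; rewrite mem_head.
  by apply: IHs => y s_y; apply: sY; rewrite inE s_y orbT.
move: h; apply: smallest_sub; [split|] => /=.
- by exists [::].
- move=> _ _ [s sY ->] [t tY ->]; exists (s ++ t); last by rewrite gen_word_cat.
  by move=> x; rewrite mem_cat => /orP[/sY|/tY].
- by move=> _ [x Yx <-]; exists [:: x] => [y|]; rewrite ?inE /= ?mulg1 // => /eqP->.
Qed.

Lemma structure_monoidP h : M h <-> exists s, h = gen_word s.
Proof.
apply: (iff_trans (submonoid_gen_wordP [set: X] h)).
by split=> [[s _ ->]|[s ->]]; exists s.
Qed.

(** * Invariant subsets and words supported in them *)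

Lemma perm_stable (s : {perm X}) (Y : set X) :
  (forall y, Y y -> Y (s y)) -> forall y, Y (s y) <-> Y y.
Proof.
move=> sY y; split; last exact: sY.
pose A := [set y | `[< Y y >]]%SET.
have memA z : reflect (Y z) (z \in A) by rewrite finset.in_set; apply: asboolP.
(* An injective map of a finite set into itself is onto. *)
have sA : s @: A = A.
  apply/eqP; rewrite eqEcard card_imset ?leqnn ?andbT; last exact: perm_inj.
  by apply/fintype.subsetP=> _ /imsetP[z /memA/sY Ysz ->]; apply/memA.
move=> /memA; rewrite -{1}sA => /imsetP[z /memA Yz /perm_inj ->//].
Qed.

Lemma invariantE (Y : set X) :
  Defs.invariant S Y <-> forall x y, Y x -> Y y -> Y (g_ x y) /\ Y (f_ y x).
Proof.
split=> [invY x y Yx Yy|invY _ [[x y] [/= Yx Yy] <-]].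
  have /invY : (S @` (Y `*` Y)) (S (x, y)) by exists (x, y).
  by rewrite sol_pairE.
by rewrite sol_pairE; split; have [] := invY x y Yx Yy.
Qed.

(** The two properties are proved together: the support of the cocycle of a product or an inverse
    stays in Y because the action preserves Y. *)
Lemma invariant_G (Y : set X) h : Defs.invariant S Y -> G_ S Y h ->
  (forall y, Y (phi h y) <-> Y y) /\ (forall y, ~ Y y -> pi h y = 0%R).
Proof.
move=> /invariantE invY; move: h; apply: smallest_sub; last first.
  move=> _ [x Yx <-] /=; rewrite phi_gen; split=> y; last first.
    by rewrite pi_gen; case: eqP => // ->.
  rewrite -[in X in _ <-> Y X](permKV (g_perm x) y).
  apply: iff_sym; apply: perm_stable => {}y Yy.
  by rewrite permE; have [] := invY x y Yx Yy.
split=> [|h [phi_h pi_h]]; first split=> [|h k [phi_h pi_h] [phi_k pi_k]].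
- by split=> y; rewrite ?phi1 ?perm1 ?pi1.
- split=> y; first by rewrite phiM permM phi_k.
  by move=> Y'y; rewrite piM pi_h // pi_k ?addr0 // phi_h.
have phi_hV y : Y (phi h^-1 y) <-> Y y by rewrite -phi_h phiV permKV.
by split=> // y Y'y; rewrite piV pi_h ?oppr0 // -phiV phi_hV.
Qed.

Lemma gen_word_count (Y : set X) l : Defs.invariant S Y ->
  (forall x, x \in l -> Y x) ->
  exists2 s : seq X, (forall x, x \in s -> Y x) &
    forall y, pi (gen_word s) y = count_mem y l.
Proof.
move=> invY; elim: l => [|x l IHl] lY.
  by exists [::] => // y; rewrite pi1.
have [y l_y|s sY pi_s] := IHl; first by apply: lY; rewrite inE l_y orbT.
have [phi_s _] := invariant_G invY (gen_word_G sY).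
(* Appending a letter a to s adds (phi s y == a) to the cocycle at y, so a = phi s x contributes
   exactly e_x; it lies in Y because phi s preserves Y. *)
exists (s ++ [:: phi (gen_word s) x]) => y.
  rewrite mem_cat inE => /orP[/sY//|/eqP->].
  by apply/phi_s/lY; rewrite mem_head.
rewrite gen_word_cat /= mulg1 piM pi_s pi_gen (inj_eq perm_inj).
by rewrite [y == x]eq_sym PoszD addrC.
Qed.

Lemma gen_word_surj (Y : set X) (a : X -> int) : Defs.invariant S Y ->
  (forall y, 0 <= a y)%R -> (forall y, ~ Y y -> a y = 0%R) ->
  exists2 s : seq X, (forall x, x \in s -> Y x) & pi (gen_word s) =1 a.
Proof.
move=> invY a_ge0 aY.
pose l := flatten [seq nseq `|a x|%N x | x <- enum X].
have [x|s sY pi_s] := @gen_word_count Y l invY.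
  case/flatten_mapP=> y _; rewrite mem_nseq => /andP[ay /eqP->].
  by apply: contrapT => /aY ay0; rewrite ay0 in ay.
exists s => // y; rewrite pi_s count_flatten -map_comp sumnE big_map.
rewrite big_enum /= (bigD1 y) //= big1 => [|x /negPf neq_xy]; rewrite count_nseq /=.
  by rewrite eqxx; have := a_ge0 y; lia.
by rewrite neq_xy.
Qed.

Lemma setT_invariant : Defs.invariant S [set: X].
Proof. by apply/invariantE. Qed.

Lemma structure_monoid_surj (a : X -> int) : (forall y, 0 <= a y)%R ->
  exists2 h, M h & pi h =1 a.
Proof.
move=> a_ge0; have [|s _ pi_s] := gen_word_surj setT_invariant a_ge0.
  by move=> y /(_ I).
by exists (gen_word s) => //; apply/structure_monoidP; exists s.
Qed.

Lemma structure_monoid_pi_inj h k : M h -> M k -> pi h =1 pi k -> h = k.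
Proof.
by move=> /structure_monoidP[s ->] /structure_monoidP[t ->] /gen_word_pi_inj.
Qed.

Lemma structure_monoid_submonoid : is_submonoid M.
Proof. exact: submonoid_gen_submonoid. Qed.

(** * From the monoid to the whole group *)

Lemma pi_one_expg d k y : pi d =1 (fun=> 1%R) -> pi (d ^+ k) y = k.
Proof.
move=> pi_d; elim: k y => [|k IHk] y; first by rewrite pi1.
by rewrite expgS piM IHk pi_d; lia.
Qed.

(* [pi d = (1, ..., 1)] makes d normalize M, so the denominators of a word of generators
   and their inverses can be gathered on the right. *)
Lemma structure_group_fraction d h : M d -> pi d =1 (fun=> 1%R) ->
  exists k, M (h * d ^+ k).
Proof.
move=> Md pi_d; have [M1 MM] := structure_monoid_submonoid.
rewrite -[h]pg_classK; elim: (repr h) => [|[x b] w [k Mwk]].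
  by exists 0; rewrite mulg1.
have -> : pg_class (structure_relation S) ((x, b) :: w) =
  (if b then (gen x)^-1 else gen x) * pg_class (structure_relation S) w.
- have -> : (if b then (gen x)^-1 else gen x) =
    pg_class (structure_relation S) [:: (x, b)].
    case: b => //; apply: (mulgI (gen x)); rewrite mulgV; symmetry.
    apply: (etrans (pg_mulE _ _ _)); apply/pg_classP.
    exact: (we_free _ (x, false)).
  by symmetry; apply: pg_mulE.
case: b; last first.
  exists k; rewrite -mulgA; apply: MM => //.
  by apply/structure_monoidP; exists [:: x]; rewrite /= mulg1.
set m := pg_class _ w * _ in Mwk.
(* [m'] is d^-1 m d, obtained inside M from its cocycle: pi (m d) = pi m + 1, while pi (d m') y = 1
   + pi m' (phi d y). *)
have [y|m' Mm' pi_m'] :=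
  @structure_monoid_surj (fun y => pi m ((phi d)^-1%g y)).
  by have /structure_monoidP[s ->] := Mwk; apply: pi_gen_word_ge0.
have def_md : m * d = d * m'.
  apply: structure_monoid_pi_inj; [exact: MM | exact: MM |] => y.
  by rewrite (piM m) (piM d) pi_m' permK !pi_d addrC.
(* Since d starts with x up to exchange, x^-1 m d = (x^-1 d) m' is a product of elements of M. *)
have /structure_monoidP[s def_d] := Md.
have [|t def_dt] := @gen_word_exchange s x; first by rewrite -def_d pi_d.
exists k.+1; rewrite expgSr -mulgA (mulgA _ (d ^+ k)) -/m def_md.
rewrite {1}def_d def_dt -!mulgA mulKg; apply: MM => //.
by apply/structure_monoidP; exists t.
Qed.

(** Right multiplication by d^n adds the constant n to [pi], so both elements can be moved into M by
    one common power and compared there. *)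
Lemma pi_inj h k : pi h =1 pi k -> h = k.
Proof.
move=> eq_hk; have [M1 MM] := structure_monoid_submonoid.
have [//|d Md pi_d] := @structure_monoid_surj (fun=> 1%R).
have MX n : M (d ^+ n) by elim: n => [|n IHn] //; rewrite expgS; apply: MM.
have [m Mhm] := structure_group_fraction h Md pi_d.
have [n Mkn] := structure_group_fraction k Md pi_d.
apply: (mulIg (d ^+ (m + n))); apply: structure_monoid_pi_inj.
- by rewrite expgnDr mulgA; apply: MM.
- by rewrite addnC expgnDr mulgA; apply: MM.
- by move=> y; rewrite !piM !pi_one_expg // eq_hk.
Qed.

Lemma structure_monoid_pi h : M h <-> forall y, (0 <= pi h y)%R.
Proof.
split=> [/structure_monoidP[s ->] y|/structure_monoid_surj[k Mk /pi_inj <-//]].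
exact: pi_gen_word_ge0.
Qed.

Lemma pi_surj (a : X -> int) : exists h, pi h =1 a.
Proof.
have [//|d _ pi_d] := @structure_monoid_surj (fun=> 1%R).
(* [k] bounds every |a y|, so a + k is realized in M; division by d^k then subtracts k. *)
pose k := (\sum_y `|a y|)%N.
have le_ak y : (`|a y| <= k)%N by rewrite /k (bigD1 y) //= leq_addr.
have [y|h _ pi_h] := @structure_monoid_surj (fun y => (a y + k%:Z)%R).
  by have := le_ak y; lia.
exists (h * (d ^+ k)^-1) => y.
by rewrite piM pi_h piV pi_one_expg //; lia.
Qed.

(** * Divisibility as a pointwise order *)

Lemma ldivides_pi x z : ldivides M x z <-> forall y, (pi x y <= pi z y)%R.
Proof.
split=> [[t /structure_monoid_pi t_ge0 ->] y|le_xz].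
  by rewrite piM lerDl.
(* The cocycle of x^-1 z is pi z - pi x composed with phi x^-1. *)
exists (x^-1 * z); last by rewrite mulVKg.
apply/structure_monoid_pi => y.
by rewrite piM piV phiV addrC subr_ge0.
Qed.

(* The right cocycle h |-> h^-1 . pi h, for which right divisibility plays the
   role that left divisibility plays for [pi]. *)
Definition rho (h : G) (y : X) : int := pi h ((phi h)^-1 y).

Lemma rho_piV h y : rho h y = (- pi h^-1%g y)%R.
Proof. by rewrite piV opprK. Qed.

Lemma rho_phi h y : rho h (phi h y) = pi h y.
Proof. by rewrite /rho permK. Qed.

Lemma rho_inj h k : rho h =1 rho k -> h = k.
Proof.
move=> e; apply/invg_inj/pi_inj => y; apply: oppr_inj.
by rewrite -!rho_piV e.
Qed.

Lemma rho_surj (a : X -> int) : exists h, rho h =1 a.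
Proof.
have [h pi_h] := pi_surj (fun y => - a y)%R.
by exists h^-1 => y; rewrite rho_piV invgK pi_h opprK.
Qed.

Lemma structure_monoid_rho h : M h <-> forall y, (0 <= rho h y)%R.
Proof.
apply: (iff_trans (structure_monoid_pi h)); split=> h_ge0 y; first exact: h_ge0.
by rewrite -rho_phi.
Qed.

Lemma rdivides_rho x z : rdivides M x z <-> forall y, (rho x y <= rho z y)%R.
Proof.
have pi_zxV y : pi (z * x^-1) y = (rho z (phi z y) - rho x (phi z y))%R.
  by rewrite piM rho_phi rho_piV opprK.
split=> [[t /structure_monoid_pi t_ge0 def_z] y|le_xz].
  have := t_ge0 ((phi z)^-1 y).
  have -> : t = z * x^-1 by rewrite def_z mulgK.
  by rewrite pi_zxV permKV subr_ge0.
exists (z * x^-1); last by rewrite mulgVK.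
by apply/structure_monoid_pi => y; rewrite pi_zxV subr_ge0.
Qed.

Lemma pi_ge0 x : M x -> forall y, (0 <= pi x y)%R.
Proof. by move/structure_monoid_pi. Qed.

(** * Noetherianity and least common multiples, for [pi] and [rho] at once *)

Section PointwiseOrder.
Variables (q : G -> X -> int) (dv : G -> G -> Prop).
Hypothesis q_inj : forall h k, q h =1 q k -> h = k.
Hypothesis q_surj : forall a : X -> int, exists h, q h =1 a.
Hypothesis monoid_q : forall h, M h <-> forall y, (0 <= q h y)%R.
Hypothesis dv_q : forall x z, dv x z <-> forall y, (q x y <= q z y)%R.

Lemma pointwise_noetherian : noetherian_for M dv.
Proof.
move=> u Mu dvu; have [||n0 stat] := @nonincreasing_nneg_stationary _ (q \o u).
- by move=> n; apply/monoid_q.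
- by move=> n; apply/dv_q.
by exists n0 => n /stat/q_inj.
Qed.

Lemma pointwise_lcms : has_conditional_lcms M dv.
Proof.
move=> x y /monoid_q x_ge0 _; split=> [_|[m [xym _]]]; last by exists m.
have [m q_m] := q_surj (fun w => Num.max (q x w) (q y w)).
exists m; split=> [|z [_ /dv_q xz /dv_q yz]]; last first.
  by apply/dv_q => w; rewrite q_m ge_max xz yz.
split; first by apply/monoid_q => w; rewrite q_m le_max x_ge0.
  by apply/dv_q => w; rewrite q_m le_max lexx.
by apply/dv_q => w; rewrite q_m le_max lexx orbT.
Qed.

End PointwiseOrder.

Lemma structure_monoid_locally_garside : locally_garside M.
Proof.
have noeL := pointwise_noetherian pi_inj structure_monoid_pi ldivides_pi.
have noeR := pointwise_noetherian rho_inj structure_monoid_rho rdivides_rho.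
have lcmL := pointwise_lcms pi_surj structure_monoid_pi ldivides_pi.
have lcmR := pointwise_lcms rho_surj structure_monoid_rho rdivides_rho.
split=> //; first exact: submonoid_gen_submonoid.
by move=> x y t z _ _ _ _ /mulIg/mulgI.
Qed.

(** * Balanced elements attached to invariant subsets *)

Definition indicator (Y : set X) (y : X) : int := Posz `[< Y y >].

Lemma le_indicator (Y : set X) (a : X -> int) :
  (forall y, a y <= indicator Y y)%R ->
  (forall y, 0 <= a y)%R -> forall y, ~ Y y -> a y = 0%R.
Proof.
move=> aY a_ge0 y /asboolPn/negPf Y'y; apply/eqP.
by rewrite eq_le a_ge0 andbT; have := aY y; rewrite /indicator Y'y.
Qed.

Lemma structure_monoid_supported (Y : set X) h : Defs.invariant S Y -> M h ->
  (forall y, ~ Y y -> pi h y = 0%R) ->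
  exists2 s : seq X, (forall x, x \in s -> Y x) & h = gen_word s.
Proof.
move=> invY Mh hY.
have [s sY pi_s] := gen_word_surj invY (pi_ge0 Mh) hY.
by exists s => //; apply: pi_inj => y; rewrite pi_s.
Qed.

(** Divisors of d on either side lie in [G_ S Y], whose action fixes 1_Y. For such x, pi x <= 1_Y
    and rho x <= 1_Y are equivalent, and rho d = 1_Y too. *)
Lemma indicator_balanced (Y : set X) d : Defs.invariant S Y ->
  pi d =1 indicator Y -> balanced M d.
Proof.
move=> invY pi_d.
have Md : M d by apply/structure_monoid_pi => y; rewrite pi_d.
have inG t : M t -> ldivides M t d -> G_ S Y t.
  move=> Mt /ldivides_pi le_td.
  have [|s sY ->] := @structure_monoid_supported Y t invY Mt.
    apply: le_indicator => [y|]; last exact: pi_ge0.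
    by rewrite -pi_d.
  exact: gen_word_G.
have Gd : G_ S Y d by apply: inG => //; apply/ldivides_pi.
have ind_phi h y : G_ S Y h -> indicator Y (phi h y) = indicator Y y.
  case/(invariant_G invY) => phi_h _; congr (Posz (nat_of_bool _)).
  exact: asbool_equiv_eq.
have rho_d y : rho d y = indicator Y y.
  by rewrite /rho pi_d -(ind_phi d) // permKV.
split=> //; apply/seteqP; split=> x [Mx dv_xd]; split=> //.
  have Gx := inG x Mx dv_xd; apply/rdivides_rho => y.
  rewrite rho_d -[y](permKV (phi x)) rho_phi ind_phi // -pi_d.
  by move/ldivides_pi: dv_xd; apply.
(* When d = t x, the cofactor t is a left divisor of d, so t and hence x = t^-1 d lie in
   [G_ S Y]. *)
have Gx : G_ S Y x.
  have [t Mt def_d] := dv_xd.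
  have Gt : G_ S Y t by apply: inG => //; exists x.
  have -> : x = t^-1 * d by rewrite def_d mulKg.
  have [[_ HM] HV] := subgroup_gen_subgroup (gen @` Y).
  by apply: HM => //; apply: HV.
apply/ldivides_pi => y; rewrite pi_d -(ind_phi x) // -rho_d -rho_phi.
by move/rdivides_rho: dv_xd; apply.
Qed.

(** * The Garside element *)

Lemma indicatorT y : indicator [set: X] y = 1%R.
Proof. by rewrite /indicator asboolT. Qed.

Lemma pi_one_garside_element D : pi D =1 (fun=> 1%R) -> garside_element M D.
Proof.
move=> pi_D; split.
  by apply: (indicator_balanced setT_invariant) => y; rewrite indicatorT.
apply/seteqP; split.
  by apply: smallest_sub => [|x []//]; apply: submonoid_gen_submonoid.
apply: sub_smallest2r => [|_ [x _ <-]]; first exact: submonoid_gen_submonoid.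
split; first by apply: sub_gen_smallest; exists x.
by apply/ldivides_pi => y; rewrite pi_gen pi_D; case: eqP.
Qed.

(** Generators are atoms: if h k = gen y in M, then pi h is e_y or 0, so h = gen y or h = 1. Hence
    gen y belongs to every generating set of M, in particular to the divisors of d. *)
Lemma garside_element_ge1 d : garside_element M d -> forall y, (1 <= pi d y)%R.
Proof.
move=> [_ genM] y; have [M1 MM] := structure_monoid_submonoid.
have gen_y : submonoid_gen (Div M d) (gen y).
  by rewrite genM; apply: sub_gen_smallest; exists y.
suff sub_P : submonoid_gen (Div M d) `<=`
    [set h | M h /\ (h = gen y -> (1 <= pi d y)%R)].
  by have [_] := sub_P _ gen_y; apply.
apply: smallest_sub => [|h [Mh /ldivides_pi le_hd]]; last first.
  by split=> // def_h; have := le_hd y; rewrite def_h pi_gen eqxx.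
split; first by split=> // /(congr1 (fun h => pi h y)); rewrite pi1 pi_gen eqxx.
move=> h k [Mh Ph] [Mk Pk]; split=> [|def_hk]; first exact: MM.
have pi_hk z : (pi h z + pi k (phi h z))%R = (z == y).
  by rewrite -piM def_hk pi_gen.
have [pi_hy|pi_hy] := eqVneq (pi h y) 1%R.
  apply/Ph/pi_inj => z; rewrite pi_gen; have := pi_hk z.
  have := pi_ge0 Mh z; have := pi_ge0 Mk (phi h z).
  by have [->|_] := eqVneq z y; rewrite ?pi_hy; lia.
apply: Pk; rewrite -def_hk; suff -> : h = 1 by rewrite mul1g.
apply: pi_inj => z; rewrite pi1; have := pi_hk z.
have := pi_ge0 Mh z; have := pi_ge0 Mk (phi h z).
by have [->|_] := eqVneq z y; lia.
Qed.

(** Every Garside element is a multiple of the one with constant cocycle 1, so minimality selects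
    the latter. *)
Lemma minimal_garsideP D :
  minimal_garside_element M D <-> pi D =1 (fun=> 1%R).
Proof.
have [D1 pi_D1] := pi_surj (fun=> 1%R).
have garD1 := pi_one_garside_element pi_D1.
split=> [[_ garD minD]|pi_D].
  rewrite -(minD D1) //; apply/ldivides_pi => y; rewrite pi_D1.
  exact: garside_element_ge1.
have garD := pi_one_garside_element pi_D; split=> //.
  by split; [exact: structure_monoid_locally_garside | exists D].
move=> d gard /ldivides_pi le_dD; apply: pi_inj => y; apply: le_anti.
by rewrite le_dD pi_D garside_element_ge1.
Qed.

(** * The correspondence *)

Lemma invariant_restriction (Y : set X) :
  Defs.invariant S Y -> invariant_nondegenerate S Y.
Proof.
move=> invY; exists invY; have [_ _ invS brS] := hS.
have invR : involutive (restriction invY).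
  move=> [[x Yx] [y Yy]]; rewrite /restriction /=.
  by congr (_, _); apply: val_inj; rewrite /= -surjective_pairing invS.
split=> //; first by exists (restriction invY).
  (* The restricted maps are injective on a finite set, hence bijective. *)
  move=> x; split; apply: (@injF_bij {y : X | y \in Y}) => y z.
    by move/(congr1 val) => /= /(@sol_f_inj (val x)) /val_inj.
  by move/(congr1 val) => /= /(@sol_g_inj (val x)) /val_inj.
pose v3 (t : Y * Y * Y) := (val t.1.1, val t.1.2, val t.2).
have v3_inj : injective v3.
  by move=> [[x y] z] [[x' y'] z'] [/val_inj-> /val_inj-> /val_inj->].
have v3_S12 t : v3 (S12 (restriction invY) t) = S12 S (v3 t).
  by rewrite /v3 /S12 /= -surjective_pairing.
have v3_S23 t : v3 (S23 (restriction invY) t) = S23 S (v3 t).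
  by case: t => [[x y] z]; rewrite /v3 /S23 /=; case: (S _).
by move=> t; apply: v3_inj; rewrite !(v3_S12, v3_S23).
Qed.

(** The cocycle of gen y is nonzero at y, whereas cocycles of elements of [G_ S Z] are supported in
    Z. *)
Lemma G_inj (Y Z : set X) : Defs.invariant S Z -> G_ S Y = G_ S Z -> Y `<=` Z.
Proof.
move=> invZ eqG y Yy.
have /(invariant_G invZ)[_ pi_y] : G_ S Z (gen y).
  by rewrite -eqG; apply: sub_gen_smallest; exists y.
by apply: contrapT => /pi_y; rewrite pi_gen eqxx.
Qed.

Lemma subgroup_gen_sub (T : groupType) (A B : set T) :
  A `<=` subgroup_gen B -> subgroup_gen A `<=` subgroup_gen B.
Proof. by apply: smallest_sub; apply: subgroup_gen_subgroup. Qed.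

Lemma subgroup_submonoid_gen (T : groupType) (A : set T) :
  subgroup_gen (submonoid_gen A) = subgroup_gen A.
Proof.
apply/seteqP; split; apply: subgroup_gen_sub => x Ax; last first.
  by apply: sub_gen_smallest; apply: sub_gen_smallest.
by move=> H [[Hm _] subH]; apply: Ax.
Qed.

Lemma G_parabolic (Y : set X) : Defs.invariant S Y ->
  standard_parabolic_subgroup M (G_ S Y).
Proof.
move=> invY; exists (submonoid_gen (gen @` Y)); last first.
  by rewrite subgroup_submonoid_gen.
have [D pi_D] := pi_surj (fun=> 1%R); have [d pi_d] := pi_surj (indicator Y).
have Md : M d by apply/structure_monoid_pi => y; rewrite pi_d.
have Y_div x : Div M d x -> submonoid_gen (gen @` Y) x.
  move=> [Mx /ldivides_pi le_xd]; apply/submonoid_gen_wordP.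
  apply: structure_monoid_supported => //.
  apply: le_indicator => [y|]; last exact: pi_ge0.
  by rewrite -pi_d.
exists D, d; split.
- exact/minimal_garsideP.
- exact: indicator_balanced pi_d.
- split=> //; apply/ldivides_pi => y; rewrite pi_D pi_d /indicator.
  by case: asbool.
- apply/seteqP; split; apply: smallest_sub => //; try exact: submonoid_gen_submonoid.
  move=> _ [x Yx <-]; apply: sub_gen_smallest; split.
    by apply: sub_gen_smallest; exists x.
  apply/ldivides_pi => y; rewrite pi_gen pi_d /indicator.
  by case: eqP => // ->; rewrite asboolT.
apply/seteqP; split=> x.
  (* Membership in N puts the support of pi x in Y, and dividing D bounds its values by 1; together
     they give pi x <= 1_Y. *)
  move=> [/submonoid_gen_wordP[s sY def_x] [Mx /ldivides_pi le_xD]].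
  split=> //; apply/ldivides_pi => y; rewrite pi_d /indicator.
  case: asboolP => [_|Y'y]; first by have := le_xD y; rewrite pi_D.
  by rewrite def_x; have [_ ->] := invariant_G invY (gen_word_G sY).
move=> dx; split; first exact: Y_div.
have [Mx /ldivides_pi le_xd] := dx; split=> //; apply/ldivides_pi => y.
by rewrite pi_D (le_trans (le_xd y)) // pi_d /indicator; case: asbool.
Qed.

Lemma parabolic_G (H : set G) : standard_parabolic_subgroup M H ->
  exists2 Y, Defs.invariant S Y & H = G_ S Y.
Proof.
move=> [_ [D [d [/minimal_garsideP pi_D [Md bal_d] [_ /ldivides_pi le_dD] -> ND]] ->]].
have [M1 MM] := structure_monoid_submonoid.
have Mgen x : M (gen x) by apply: sub_gen_smallest; exists x.
have Div_l h k : M h -> M k -> Div M d (h * k) -> Div M d h.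
  move=> Mh Mk [_ [t Mt ->]]; split=> //.
  by exists (k * t); [exact: MM | rewrite mulgA].
have Div_r h k : M h -> M k -> Div M d (h * k) -> Div M d k.
  rewrite /Div bal_d => Mh Mk [_ [t Mt ->]]; split=> //.
  by exists (t * h); [exact: MM | rewrite mulgA].
pose Y := [set y | Div M d (gen y)].
exists Y.
  apply/invariantE => x y Yx Yy.
  have [eq_gx|neq_gx] := eqVneq (g_ x y) x.
    (* Here involutivity gives g_x (f_y x) = x = g_x y, so f_y x = y. *)
    have := sol_invol x y; rewrite eq_gx -[in RHS]eq_gx => /sol_g_inj ->.
    by split.
  have : Div M d (gen x * gen y).
    rewrite -ND; split.
      have [_] := submonoid_gen_submonoid (Div M d).
      by apply; apply: sub_gen_smallest.
    split; first exact: MM.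
    (* The cocycle of x y is e_x + e_{g_x y}; as g_x y differs from x, its values are at most 1. *)
    apply/ldivides_pi => z; rewrite piM !pi_gen pi_D phi_gen.
    case: (eqVneq z x) => [->|_]; last by case: eqP.
    case: eqP => // /(canRL (permKV _)); rewrite permE => eq_x.
    by rewrite -eq_x eqxx in neq_gx.
  (* The two factors of (g_x y)(f_y x) are a left and a right divisor of an element of Div d, and d
     is balanced. *)
  by rewrite gen_rel => dgf; split; [apply: Div_l dgf | apply: Div_r dgf].
rewrite subgroup_submonoid_gen; apply/seteqP.
split; apply: subgroup_gen_sub; last first.
  by move=> _ [x Yx <-]; apply: sub_gen_smallest.
(* A divisor of d is a word in the generators; peeling letters off the front shows that each letter
   divides d. *)
move=> h dh; have [/structure_monoidP[s def_h] _] := dh; rewrite {h}def_h in dh *.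
apply: gen_word_G; elim: s dh => [|x s IHs] //= dxs y.
have Ms : M (gen_word s) by apply/structure_monoidP; exists s.
rewrite inE => /orP[/eqP->|]; first by apply: Div_l dxs.
by apply: IHs; apply: Div_r dxs.
Qed.

End Cocycle.

Theorem theorem1 (X : finType) (S : X * X -> X * X)
    (hS : nondegenerate_symmetric S) :
  set_bij [set Y : set X | invariant_nondegenerate S Y]%classic
          [set H : set (structure_group S) |
            standard_parabolic_subgroup (structure_monoid S) H]%classic
          (fun Y : set X => G_ S Y).
Proof.
split=> [Y [invY _]|Y Z|H /(parabolic_G hS)[Y invY ->]].
- exact: G_parabolic.
- rewrite !inE => -[invY _] [invZ _] eqG; apply/seteqP; split.
    exact: (G_inj hS invZ).
  exact: (G_inj hS invY).
- by exists Y => //; apply: invariant_restriction.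
Qed.
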